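(* Let $I\subseteq\{1,\dots,n\}$, let $F_I=\{x\in\mathcal P_\Phi\mid (x,\breve\omega_i)=m_i\ \forall i\in I\}$ and $V_I=F_I\cap\Phi$. Then $F_I$ is a face of $\mathcal P_\Phi$, and, if $I\neq\emptyset$, $V_I$ is a principal abelian dual order ideal of $\Phi^+$. Moreover: (1) if $I\neq\emptyset$, $V_I$ is in bijection with the set of positive roots in $\widehat\Phi(\widehat\Pi\setminus\Pi_I)\setminus\Phi(\Pi\setminus\Pi_I)$, and through this bijection the vertices of $F_I$ correspond to the positive long roots in this set; (2) the number of vertices of $F_I$ is $[W\langle\Pi\setminus\Pi_I\rangle : W\langle(\Pi\setminus\Pi_I)\cap\theta^\perp\rangle]$.
   Context: $\Phi$ is a finite irreducible reduced crystallographic root system of rank $n$ in the Euclidean space $\mathrm{Span}_{\mathbb R}\Phi$ with scalar product $(\cdot,\cdot)$; $\Pi=\{\alpha_1,\dots,\alpha_n\}$ is a root basis, $\Phi^+$ the positive roots, $W$ the Weyl group, $\theta=\sum_{i=1}^n m_i\alpha_i$ the highest root, and $\breve\omega_1,\dots,\breve\omega_n$ the basis dual to $\Pi$, i.e. $(\breve\omega_i,\alpha_j)=\delta_{ij}$. $\mathcal P_\Phi$ is the convex hull of $\Phi$; $\mathcal P_\Phi$ is regarded as a face of itself. For $I\subseteq\{1,\dots,n\}$, $\Pi_I=\{\alpha_i\mid i\in I\}$. For $\Gamma\subseteq\Phi$, $W\langle\Gamma\rangle$ is the subgroup of $W$ generated by the reflections $s_\alpha$, $\alpha\in\Gamma$.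 If $\Phi$ is simply laced, all roots are long. Affine root system: in $\mathrm{Span}_{\mathbb R}\Phi\oplus\mathbb R\delta$, with the scalar product extended so that $\mathbb R\delta$ is the kernel, $\widehat\Phi=\{\alpha+k\delta\mid\alpha\in\Phi,k\in\mathbb Z\}$, $\alpha_0=-\theta+\delta$, $\widehat\Pi=\Pi\cup\{\alpha_0\}$, $\widehat\Phi^+=\Phi^+\cup\{\alpha+k\delta\mid\alpha\in\Phi,k\geq1\}$. A root $\alpha+k\delta$ is long if $\alpha$ is long. For $\Gamma\subseteq\Pi$ (resp. $\Gamma\subseteq\widehat\Pi$), $\Phi(\Gamma)$ (resp. $\widehat\Phi(\Gamma)$) is the standard parabolic root subsystem of $\Phi$ (resp. $\widehat\Phi$) generated by $\Gamma$. $\Phi^+$ is partially ordered by: $\alpha\leq\beta$ iff $\beta-\alpha$ is a nonnegative linear combination of positive roots. A dual order ideal is a subset $V\subseteq\Phi^+$ such that $\alpha\in V$, $\beta\geq\alpha$ imply $\beta\in V$; it is abelian if $(V+V)\cap\Phi=\emptyset$ (equivalently, the corresponding ideal $\bigoplus_{\alpha\in V}\mathfrak g_\alpha$ of the standard Borel subalgebra of the complex simple Lie algebra with root system $\Phi$ is abelian), and principal if it has a minimum. *)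

(* Defs.v *)
From HB Require Import structures.
From mathcomp Require Import all_boot all_order all_algebra.
From mathcomp Require Import classical_sets functions cardinality reals.

Set Implicit Arguments.
Unset Strict Implicit.
Unset Printing Implicit Defensive.

Import Order.TTheory GRing.Theory Num.Theory.

Local Open Scope classical_set_scope.
Local Open Scope ring_scope.

Section Generic.
Variables (R : realType) (E : lmodType R).

Definition cone (A : set E) : set E :=
  [set x | exists k (p : 'I_k -> E) (c : 'I_k -> R),
     (forall i, A (p i)) /\ (forall i, 0 <= c i) /\
     x = \sum_(i < k) c i *: p i].

Definition conv (A : set E) : set E :=
  [set x | exists k (p : 'I_k -> E) (c : 'I_k -> R),
     (forall i, A (p i)) /\ (forall i, 0 <= c i) /\
     \sum_(i < k) c i = 1 /\ x = \sum_(i < k) c i *: p i].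

Variable dot : E -> E -> R.

Definition reflection (a x : E) : E := x - (2 * dot x a / dot a a) *: a.

Definition root_subsystem (Phi S : set E) : Prop :=
  S `<=` Phi /\ (forall a b, S a -> S b -> S (reflection a b)).

(* When G consists of simple roots, this is the standard parabolic root
   subsystem generated by G. *)
Definition gen_subsystem (Phi G : set E) : set E :=
  smallest (root_subsystem Phi) G.

(* Subgroups of the group of bijections of E, under composition. *)
Definition is_subgroup (S : set (E -> E)) : Prop :=
  [/\ S id,
      forall g h, S g -> S h -> S (g \o h) &
      forall g, S g -> exists h, [/\ S h, cancel g h & cancel h g]].

Definition refl_group (G : set E) : set (E -> E) :=
  smallest is_subgroup [set reflection a | a in G].

Definition lcosets (G H : set (E -> E)) : set (set (E -> E)) :=
  [set [set g \o h | h in H] | g in G].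

Definition is_face (P F : set E) : Prop :=
  F = P \/
  exists (v : E) (c : R),
    [/\ v != 0, (forall x, P x -> dot x v <= c),
        F = [set x | P x /\ dot x v = c] & F !=set0].

(* Vertices are the zero-dimensional faces. *)
Definition vertices (P : set E) : set E := [set x | is_face P [set x]].

End Generic.

Section Roots.
Variables (R : realType) (V : vectType R) (dot : {dot V for idfun}).

Record irreducible_root_system (Phi : set V) : Prop := IrreducibleRootSystem {
  rs_finite : finite_set Phi;
  rs_nonzero : ~ Phi 0;
  rs_span : forall U : {vspace V}, (forall a, Phi a -> a \in U) -> U = fullv;
  rs_refl : forall a b, Phi a -> Phi b -> Phi (reflection dot a b);
  rs_crystallographic : forall a b, Phi a -> Phi b ->
    2 * dot b a / dot a a \is a Num.int;
  rs_reduced : forall a (c : R), Phi a -> Phi (c *: a) -> c = 1 \/ c = -1;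
  rs_nonempty : Phi !=set0;
  rs_irreducible : forall A B : set V, Phi = A `|` B ->
    (forall a b, A a -> B b -> dot a b = 0) -> A = set0 \/ B = set0 }.

Variable Phi : set V.

Definition long : set V :=
  [set a | Phi a /\ forall b, Phi b -> dot b b <= dot a a].

Section Simple.
Variables (n : nat) (al : 'I_n -> V).

Record root_basis : Prop := RootBasis {
  rb_root : forall i, Phi (al i);
  rb_basis : basis_of fullv [tuple al i | i < n];
  rb_sign : forall b, Phi b -> exists c : 'I_n -> nat,
    b = \sum_(i < n) (c i)%:R *: al i \/
    b = - \sum_(i < n) (c i)%:R *: al i }.

(* Pi_J; Pi itself is simple [set: 'I_n]. *)
Definition simple (J : {set 'I_n}) : set V := [set al i | i in [set` J]].

Definition pos : set V := Phi `&` cone (range al).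

Definition root_le (a b : V) : Prop := cone pos (b - a).

Definition highest_root (theta : V) : Prop :=
  pos theta /\ forall b, pos b -> root_le b theta.

Definition dual_order_ideal (S : set V) : Prop :=
  S `<=` pos /\ forall a b, S a -> pos b -> root_le a b -> S b.

Definition abelian_roots (S : set V) : Prop :=
  forall a b, S a -> S b -> ~ Phi (a + b).

Definition principal (S : set V) : Prop :=
  exists2 mu, S mu & forall b, S b -> root_le mu b.

(* Span Phi (+) R delta is V * R^o, with delta = (0, 1): the pair (x, k)
   stands for x + k delta. *)
Definition aff_dot (x y : V * R^o) : R := dot x.1 y.1.

Definition aff_incl (A : set V) : set (V * R^o) := [set (a, 0) | a in A].

Definition aff_roots : set (V * R^o) :=
  [set x | Phi x.1 /\ exists k : int, x.2 = k%:~R].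

Definition aff_pos : set (V * R^o) :=
  aff_incl pos `|` [set x | Phi x.1 /\ exists2 k : int, 1 <= k & x.2 = k%:~R].

Definition aff_simple (theta : V) : set (V * R^o) :=
  aff_incl (simple finset.setT) `|` [set (- theta, 1)].

Definition aff_long : set (V * R^o) :=
  [set x | aff_roots x /\ long x.1].

Definition root_polytope_face (m : 'I_n -> R) (om : 'I_n -> V)
    (I : {set 'I_n}) : set V :=
  [set x | conv Phi x /\ forall i, i \in I -> dot x (om i) = m i].

Definition aff_diff (theta : V) (I : {set 'I_n}) : set (V * R^o) :=
  aff_pos `&`
  (gen_subsystem aff_dot aff_roots (aff_simple theta `\` aff_incl (simple I)) `\`
   aff_incl (gen_subsystem dot Phi (simple finset.setT `\` simple I))).

End Simple.
End Roots.

(* Main.v *)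
(** The linear form sum_(i in I) (_, om_i) attains on the roots, hence on the
    polytope, its maximum sum_(i in I) m_i exactly where every coefficient
    indexed by I is maximal; so F_I is a face, its roots V_I are stable under
    the Levi Weyl group W_J, J the complement of I, and theta is the largest of
    them. Applying the longest element w0 of W_J reverses the order along J, so
    w0 theta is the minimum of V_I.

    A vertex of F_I must be a long root, because a short root is a nontrivial
    convex combination of roots; conversely, by Cauchy-Schwarz, a long root b
    is the only point of the polytope maximizing (_, b). A long root of V_I
    that is dominant for J equals theta, so the vertices form the W_J-orbit of
    theta, whose stabilizer is generated by the simple reflections fixing
    theta, by the exchange property.

    The bijection of (1) is b |-> delta - b. *)

Require Import Defs.
From HB Require Import structures.
From mathcomp Require Import all_boot all_order all_algebra.
From mathcomp Require Import boolp classical_sets functions cardinality reals.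
From mathcomp Require Import ring lra zify.

Set Implicit Arguments.
Unset Strict Implicit.
Unset Printing Implicit Defensive.

Import Order.TTheory GRing.Theory Num.Theory.

Local Open Scope classical_set_scope.
Local Open Scope card_scope.
Local Open Scope ring_scope.

(** * Finite sets, cardinalities and convex combinations *)

Lemma finite_set_argmin (R : realDomainType) (T : eqType) (A : set T)
    (f : T -> R) :
  finite_set A -> A !=set0 -> exists2 x, A x & forall y, A y -> f x <= f y.
Proof.
move=> /finite_seqP[s ->]; elim: s => [[x]//|a s IH _].
have [->|[b sb]] : s = [::] \/ exists b, b \in s.
- by case: s {IH} => [|b s]; [left|right; exists b; rewrite mem_head].
- by exists a; rewrite /= ?mem_head// => y; rewrite inE => /eqP->.
have [x sx xmin] := IH (ex_intro _ b sb).
have [fax|fxa] := leP (f a) (f x).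
  exists a; rewrite /= ?mem_head// => y; rewrite inE => /predU1P[->//|sy].
  exact: le_trans fax (xmin _ sy).
exists x; first by rewrite /= inE [x \in s]sx orbT.
by move=> y; rewrite /= inE => /predU1P[->|/xmin//]; apply: ltW.
Qed.

Lemma finite_set_argmax (R : realDomainType) (T : eqType) (A : set T)
    (f : T -> R) :
  finite_set A -> A !=set0 -> exists2 x, A x & forall y, A y -> f y <= f x.
Proof.
move=> fA A0; have [x Ax xmin] := finite_set_argmin (fun x => - f x) fA A0.
by exists x => // y /xmin; rewrite lerN2.
Qed.

(** On [G], [g] factors through [f]: [h] chooses a preimage in [G] of each value of [f], with [t] as
    default value elsewhere, so [g x = g (h (f x))]. *)
Lemma card_le_fiberwise (T A B : Type) (G : set T) (f : T -> A) (g : T -> B) :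
  (forall x y, G x -> G y -> f x = f y -> g x = g y) -> g @` G #<= f @` G.
Proof.
move=> fg; have [[t _]|G0] := pselect (exists t, G t); last first.
  have -> : G = set0 by apply/seteqP; split=> // x Gx; case: G0; exists x.
  by rewrite !image_set0.
have [h hP] : exists h : A -> T, forall x, G x -> G (h (f x)) /\ f (h (f x)) = f x.
  have /choice[h hP] : forall a, exists x, (exists2 y, G y & f y = a) -> G x /\ f x = a.
    move=> a; have [[y Gy <-]|na] := pselect (exists2 y, G y & f y = a).
      by exists y.
    by exists t.
  by exists h => x Gx; apply: hP; exists x.
suff -> : g @` G = (g \o h) @` (f @` G) by exact: card_image_le.
rewrite image_comp; apply: eq_imagel => x Gx /=.
by have [Gh fh] := hP x Gx; apply: fg => //.
Qed.

(** Applied to evaluation at [theta] and to the coset map on a reflection group, this is the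
    orbit-stabilizer count. *)
Lemma card_eq_fiberwise (T A B : Type) (G : set T) (f : T -> A) (g : T -> B) :
  (forall x y, G x -> G y -> f x = f y <-> g x = g y) -> f @` G #= g @` G.
Proof.
move=> fg; apply/card_eqPle; split; apply: card_le_fiberwise => x y Gx Gy.
  by case: (fg x y Gx Gy).
by case: (fg x y Gx Gy).
Qed.

(** The terms [d j * (M - g j)] are nonnegative and sum to zero. The bound is asked only where the
    weight is positive, since only there are the points known to lie in the face. *)
Lemma tight_combination (R : realType) k (d g : 'I_k -> R) (M : R) :
  (forall j, 0 <= d j) -> \sum_j d j = 1 -> (forall j, 0 < d j -> g j <= M) ->
  \sum_j d j * g j = M -> forall j, 0 < d j -> g j = M.
Proof.
move=> d0 d1 gM sM j dj.
have s0 : \sum_j d j * (M - g j) = 0.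
  under eq_bigr do rewrite mulrBr.
  by rewrite sumrB -mulr_suml d1 mul1r sM subrr.
have nn i : true -> 0 <= d i * (M - g i).
  have [di _|di _] := ltP 0 (d i); first by rewrite mulr_ge0 ?subr_ge0 ?gM ?d0.
  by rewrite (le_anti (introT andP (conj di (d0 i)))) mul0r.
have /eqP := psumr_eq0P nn s0 (erefl : xpredT j).
by rewrite mulf_eq0 (gt_eqF dj) subr_eq0 => /eqP.
Qed.

(** * Scalar products, reflections and words of reflections *)

Section InnerProduct.
Variables (R : realType) (V : lmodType R) (dot : {dot V for idfun}).
Implicit Types (a b x y : V) (l : seq V).
Local Notation s_ := (reflection dot).

Lemma dotC x y : dot x y = dot y x.
Proof. by rewrite hermC mul1r. Qed.

Lemma dot0l x : dot 0 x = 0. Proof. exact: linear0l. Qed.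
Lemma dotDl x y z : dot (x + y) z = dot x z + dot y z.
Proof. exact: linearDl. Qed.
Lemma dotDr x y z : dot z (x + y) = dot z x + dot z y.
Proof. by rewrite dotC dotDl !(dotC z). Qed.
Lemma dotZl k x y : dot (k *: x) y = k * dot x y.
Proof. exact: linearZl_LR. Qed.
Lemma dotZr k x y : dot x (k *: y) = k * dot x y.
Proof. by rewrite dotC dotZl dotC. Qed.
Lemma dotNl x y : dot (- x) y = - dot x y.
Proof. exact: linearNl. Qed.
Lemma dotNr x y : dot x (- y) = - dot x y.
Proof. by rewrite dotC dotNl dotC. Qed.
Lemma dot_suml I (r : seq I) (P : pred I) (F : I -> V) x :
  dot (\sum_(i <- r | P i) F i) x = \sum_(i <- r | P i) dot (F i) x.
Proof. exact: linear_sumlz. Qed.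
Lemma dot_sumr I (r : seq I) (P : pred I) (F : I -> V) x :
  dot x (\sum_(i <- r | P i) F i) = \sum_(i <- r | P i) dot x (F i).
Proof. by rewrite dotC dot_suml; apply: eq_bigr => i _; rewrite dotC. Qed.
Definition dotE := (dotDl, dotDr, dotNl, dotNr, dotZl, dotZr).

Lemma dot_gt0 x : x != 0 -> 0 < dot x x.
Proof. exact: neq0_dnorm_gt0. Qed.
Lemma dot_neq0 x : x != 0 -> dot x x != 0.
Proof. by move=> /dot_gt0/lt0r_neq0. Qed.

(** Expand the squared norm of [x - y]. For vectors of equal length this is the strict case of
    Cauchy-Schwarz. *)
Lemma dot_lt_mean x y : x != y -> 2 * dot x y < dot x x + dot y y.
Proof.
rewrite -subr_eq0 => /dot_gt0; rewrite !dotE (dotC y x); lra.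
Qed.

Lemma reflection_self a : a != 0 -> s_ a a = - a.
Proof.
move=> /dot_neq0 a0; rewrite /reflection mulfK// scaler_nat mulr2n.
by rewrite opprD addrA subrr add0r.
Qed.

Lemma reflectionD a x y : s_ a (x + y) = s_ a x + s_ a y.
Proof.
rewrite /reflection dotDl mulrDr mulrDl scalerDl.
by rewrite opprD addrACA.
Qed.

Lemma reflectionZ a k x : s_ a (k *: x) = k *: s_ a x.
Proof.
by rewrite /reflection dotZl scalerBr scalerA; congr (_ - _ *: _); ring.
Qed.

Lemma reflectionK a : a != 0 -> involutive (s_ a).
Proof.
move=> a0 x; rewrite /reflection !dotE -addrA -opprD -scalerDl.
have -> : 2 * (dot x a) / dot a a + 2 * (dot x a - 2 * dot x a / dot a a * dot a a) / dot a a = 0.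
  by field; apply: dot_neq0.
by rewrite scale0r subr0.
Qed.

Lemma dot_reflection a x y : a != 0 -> dot (s_ a x) (s_ a y) = dot x y.
Proof.
move=> /dot_neq0 a0; rewrite /reflection !dotE (dotC a y).
by field.
Qed.

(** Words give group elements a length and a last letter to induct on; the head of the list acts
    last. *)
Definition word l : V -> V := foldr (fun a f => s_ a \o f) id l.

Lemma word_cat l l' x : word (l ++ l') x = word l (word l' x).
Proof. by elim: l => //= a l ->. Qed.

Lemma wordD l x y : word l (x + y) = word l x + word l y.
Proof. by elim: l => //= a l ->; rewrite reflectionD. Qed.
Lemma wordZ l k x : word l (k *: x) = k *: word l x.
Proof. by elim: l => //= a l ->; rewrite reflectionZ. Qed.
Lemma wordN l x : word l (- x) = - word l x.
Proof. by rewrite -scaleN1r wordZ scaleN1r. Qed.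
Lemma word0 l : word l 0 = 0.
Proof. by have := wordZ l 0 0; rewrite !scale0r. Qed.
Lemma word_sum l I (r : seq I) (P : pred I) (F : I -> V) :
  word l (\sum_(i <- r | P i) F i) = \sum_(i <- r | P i) word l (F i).
Proof. exact: (big_morph _ (wordD l) (word0 l)). Qed.

Variable G : set V.
Hypothesis G0 : ~ G 0.

Lemma gen_neq0 a : G a -> a != 0.
Proof. by move=> Ga; apply: contra_notN G0 => /eqP <-. Qed.

Definition letters l := forall a, a \in l -> G a.

Lemma letters_cons a l : letters (a :: l) <-> G a /\ letters l.
Proof.
split=> [Gl|[Ga Gl] b]; last by rewrite inE => /predU1P[->|/Gl].
by split=> [|b lb]; apply: Gl; rewrite inE ?eqxx// lb orbT.
Qed.

Lemma letters_cat l l' : letters l -> letters l' -> letters (l ++ l').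
Proof. by move=> h h' a; rewrite mem_cat => /orP[/h|/h']. Qed.

Lemma letters_rev l : letters l -> letters (rev l).
Proof. by move=> h a; rewrite mem_rev => /h. Qed.

Lemma word_revK l : letters l -> cancel (word l) (word (rev l)).
Proof.
elim: l => // a l IH /letters_cons[Ga Gl] x.
by rewrite rev_cons -cats1 word_cat /= reflectionK ?gen_neq0// IH.
Qed.

Lemma wordK_rev l : letters l -> cancel (word (rev l)) (word l).
Proof. by move=> /letters_rev/word_revK; rewrite revK. Qed.

Lemma dot_word l x y : letters l -> dot (word l x) (word l y) = dot x y.
Proof.
elim: l => // a l IH /letters_cons[Ga Gl] /=.
by rewrite dot_reflection ?gen_neq0 ?IH.
Qed.

(** Reversal inverts a word because reflections are involutions, so words form a subgroup; a
    subgroup containing the reflections contains all words by induction. *)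
Lemma refl_groupE : refl_group dot G = [set word l | l in letters].
Proof.
apply/seteqP; split.
  apply: smallest_sub; last first.
    move=> _ [a Ga <-]; exists [:: a] => // b; by rewrite inE => /eqP->.
  split=> [|_ _ [l Gl <-] [l' Gl' <-]|_ [l Gl <-]].
  - by exists [::].
  - exists (l ++ l'); first exact: letters_cat.
    by apply/funext => x; rewrite word_cat.
  - exists (word (rev l)); split; [|exact: word_revK|exact: wordK_rev].
    by exists (rev l) => //; exact: letters_rev.
move=> _ [l Gl <-] S [[S1 SM _] GS].
elim: l Gl => //= a l IH /letters_cons[Ga Gl].
by apply: SM; [apply: GS; exists a | apply: IH].
Qed.

(** Words are isometries, so they conjugate a reflection into the reflection in the moved root; the
    exchange property rests on this. *)
Lemma word_refl_conj l a x : letters l ->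
  s_ (word l a) (word l x) = word l (s_ a x).
Proof.
move=> Gl; rewrite /reflection !dot_word//.
by rewrite wordD wordN wordZ.
Qed.

End InnerProduct.

(** * Coefficients on the simple roots and the highest root *)

Section RootSystem.
Variables (R : realType) (V : vectType R) (dot : {dot V for idfun}).
Variables (Phi : set V) (n : nat) (al : 'I_n -> V) (theta : V).
Variables (m : 'I_n -> R) (om : 'I_n -> V).
Hypothesis hPhi : irreducible_root_system dot Phi.
Hypothesis hPi : root_basis Phi al.
Hypothesis htheta : highest_root Phi al theta.
Hypothesis hm : theta = \sum_(i < n) m i *: al i.
Hypothesis hom : forall i j, dot (om i) (al j) = (i == j)%:R.
Implicit Types (a b x y : V) (i j : 'I_n).
Local Notation s_ := (reflection dot).
Local Notation c i x := (dot (om i) x).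

Lemma root_neq0 a : Phi a -> a != 0.
Proof. by move=> Pa; apply/eqP => a0; apply: (rs_nonzero hPhi); rewrite -a0. Qed.

Lemma rootN a : Phi a -> Phi (- a).
Proof.
by move=> Pa; rewrite -(reflection_self dot (root_neq0 Pa)); apply: (rs_refl hPhi).
Qed.

Lemma simple_root i : Phi (al i). Proof. exact: rb_root hPi i. Qed.

Lemma simple_neq0 i : al i != 0. Proof. exact/root_neq0/simple_root. Qed.

Lemma coord_simple i j : c i (al j) = (i == j)%:R. Proof. exact: hom. Qed.

Lemma coordE x : x = \sum_(i < n) c i x *: al i.
Proof.
have hX := rb_basis hPi.
have xE : x = \sum_(i < n) coord [tuple al i | i < n] i x *: al i.
  rewrite {1}(coord_basis hX (memvf x)); apply: eq_bigr => i _.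
  by rewrite (nth_map i) ?size_enum_ord// nth_ord_enum.
rewrite {1}xE; apply: eq_bigr => i _; congr (_ *: _).
rewrite {2}xE dot_sumr (bigD1 i)//= dotZr coord_simple eqxx mulr1 big1 ?addr0//.
by move=> j ji; rewrite dotZr coord_simple eq_sym (negbTE ji) mulr0.
Qed.

Lemma coord_sum (d : 'I_n -> R) i : c i (\sum_(j < n) d j *: al j) = d i.
Proof.
rewrite dot_sumr (bigD1 i)//= dotZr coord_simple eqxx mulr1 big1 ?addr0//.
by move=> j ji; rewrite dotZr coord_simple eq_sym (negbTE ji) mulr0.
Qed.

Lemma coord_theta i : c i theta = m i.
Proof. by rewrite hm coord_sum. Qed.

Lemma dot_coord x y : dot x y = \sum_(i < n) c i y * dot x (al i).
Proof. by rewrite {1}(coordE y) dot_sumr; apply: eq_bigr => i _; rewrite dotZr. Qed.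

Lemma coord_reflection i j x :
  c i (s_ (al j) x) = c i x - (2 * dot x (al j) / dot (al j) (al j)) * (i == j)%:R.
Proof. by rewrite /reflection !dotE coord_simple. Qed.

Lemma coord_reflection_neq i j x : i != j -> c i (s_ (al j) x) = c i x.
Proof. by move=> /negbTE ij; rewrite coord_reflection ij mulr0 subr0. Qed.

Lemma root_sign b : Phi b -> (forall i, 0 <= c i b) \/ (forall i, c i b <= 0).
Proof.
move=> /(rb_sign hPi)[d [->|->]]; [left|right] => i.
  by rewrite (coord_sum (fun i => (d i)%:R)).
by rewrite dotNr (coord_sum (fun i => (d i)%:R)) oppr_le0.
Qed.

Lemma cone_coord (A : set V) x i :
  (forall a, A a -> 0 <= c i a) -> cone A x -> 0 <= c i x.
Proof.
move=> A0 [k [p [d [Ap [d0 ->]]]]]; rewrite dot_sumr; apply: sumr_ge0 => j _.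
by rewrite dotZr mulr_ge0// A0.
Qed.

Lemma coord_cone (A : set V) x : (forall i, A (al i)) ->
  (forall i, 0 <= c i x) -> cone A x.
Proof.
by move=> Aal x0; exists n, al, (fun i => c i x); split=> //; split=> //; apply: coordE.
Qed.

Lemma posE b : pos Phi al b <-> Phi b /\ forall i, 0 <= c i b.
Proof.
split=> -[Pb b0]; split=> //.
  by move=> i; apply: cone_coord b0 => _ [j _ <-]; rewrite coord_simple ler0n.
by apply: coord_cone => // i; exists i.
Qed.

(** Positive roots and simple roots generate the same cone, cut out by nonnegative coefficients. *)
Lemma root_leE a b : root_le Phi al a b <-> forall i, c i a <= c i b.
Proof.
split=> [ab i|ab].
  rewrite -subr_ge0 -dotNr -dotDr; apply: cone_coord ab => d /posE[_]; exact.
apply: coord_cone => [i|i]; last by rewrite dotDr dotNr subr_ge0.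
by apply/posE; split=> [|j]; rewrite ?coord_simple ?ler0n//; apply: simple_root.
Qed.

Lemma theta_root : Phi theta. Proof. by case: htheta => /posE[]. Qed.

(** Maximality of [theta] covers positive roots; for negative ones it suffices that [theta] has
    nonnegative coefficients. *)
Lemma coord_le b i : Phi b -> c i b <= m i.
Proof.
move=> Pb; rewrite -coord_theta; case: (root_sign Pb) => b0.
  by case: htheta => _ /(_ b)/(_ _)/root_leE; apply; apply/posE.
by apply: le_trans (b0 i) _; case: htheta => /posE[].
Qed.

Lemma m_gt0 i : 0 < m i.
Proof.
apply: lt_le_trans (coord_le i (simple_root i)).
by rewrite coord_simple eqxx ltr01.
Qed.

(** Otherwise reflecting [theta] in [al i] would give a root with [i]-th coefficient above [m i]. *)
Lemma theta_dominant i : 0 <= dot theta (al i).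
Proof.
have := coord_le i (rs_refl hPhi (simple_root i) theta_root).
rewrite coord_reflection coord_theta eqxx mulr1 gerBl.
by rewrite pmulr_lge0 ?invr_gt0 ?dot_gt0 ?simple_neq0// pmulr_rge0.
Qed.

(** The reflection changes only the [i]-th coefficient, so the others are both nonnegative and
    nonpositive; [b] is then a multiple of [al i], and the system is reduced. *)
Lemma reflection_simple_neg b i : Phi b -> (forall j, 0 <= c j b) ->
  (forall j, c j (s_ (al i) b) <= 0) -> b = al i.
Proof.
move=> Pb b0 sb0.
have bE : b = c i b *: al i.
  rewrite {1}(coordE b) (bigD1 i)//= big1 ?addr0// => j ji.
  have := sb0 j; rewrite coord_reflection_neq// => bj.
  by rewrite (le_anti (introT andP (conj bj (b0 j)))) scale0r.
have := @rs_reduced _ _ _ _ hPhi (al i) (c i b) (simple_root i).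
rewrite -bE => /(_ Pb)[bi|bi]; first by rewrite bE bi scale1r.
by have := b0 i; rewrite bi ler0N1.
Qed.

(** * The Levi Weyl group, generated by the simple reflections outside [I] *)

Section Parabolic.
Variable I : {set 'I_n}.
Local Notation G := (simple al finset.setT `\` simple al I).

Lemma al_inj : injective al.
Proof.
move=> i j ij; apply/eqP; have := coord_simple i j.
by rewrite -ij coord_simple eqxx => /eqP; rewrite eqr_nat; case: (i == j).
Qed.

Lemma leviE a : G a <-> exists2 j, j \notin I & a = al j.
Proof.
split=> [[[j _ <-] nI]|[j nI ->]].
  by exists j => //; apply/negP => jI; apply: nI; exists j.
split; first by exists j => //=; rewrite inE.
by move=> [i /= iI /al_inj ij]; rewrite -ij iI in nI.
Qed.

Lemma levi_simple j : j \notin I -> G (al j).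
Proof. by move=> jI; apply/leviE; exists j. Qed.

Lemma levi_not0 : ~ G 0.
Proof. by move=> /leviE[j _ j0]; have := simple_neq0 j; rewrite -j0 eqxx. Qed.

Lemma word_root l b : letters G l -> Phi b -> Phi (word dot l b).
Proof.
elim: l => // a l IH /letters_cons[/leviE[j jI ->] Gl] Pb /=.
by apply: (rs_refl hPhi); [apply: simple_root|apply: IH].
Qed.

Lemma coord_word l x i : letters G l -> i \in I -> c i (word dot l x) = c i x.
Proof.
move=> + iI; elim: l => // a l IH /letters_cons[/leviE[j jI ->] Gl] /=.
by rewrite coord_reflection_neq ?IH//; apply: contraNneq jI => <-.
Qed.

(* A word is determined on [x] by the images of the simple roots, which lie in
   the finite set [Phi]. *)
Lemma finite_orbit x : finite_set [set word dot l x | l in letters G].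
Proof.
have /finite_seqP[s sE] := rs_finite hPhi.
pose g (t : {ffun 'I_n -> seq_sub s}) := \sum_i c i x *: ssval (t i).
apply: (@sub_finite_set _ _ (range g)); last exact/finite_image/finite_finset.
move=> _ [l Gl <-].
have ws i : word dot l (al i) \in s.
  by have := word_root Gl (simple_root i); rewrite sE.
exists [ffun i => SeqSub (ws i)] => //.
rewrite [in RHS](coordE x) word_sum; apply: eq_bigr => i _.
by rewrite ffunE wordZ.
Qed.

Local Notation rho := (\sum_i om i).

(** Pairing with [rho] is thus the height, the quantity optimized when extremal elements are
    chosen. *)
Lemma dot_rho_simple j : dot rho (al j) = 1.
Proof.
rewrite dot_suml (bigD1 j)//= coord_simple eqxx big1 ?addr0// => i ij.
by rewrite coord_simple (negbTE ij).
Qed.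

(** Take a point of maximal height in the finite orbit: reflecting it in a Levi simple root pairing
    negatively with it would raise the height. *)
Lemma orbit_dominant x : exists2 l, letters G l &
  forall j, j \notin I -> 0 <= dot (word dot l x) (al j).
Proof.
have [|_ [l Gl <-] lmax] := finite_set_argmax (fun y => dot rho y) (finite_orbit x).
  by exists x, [::].
exists l => // j jI.
have Gjl : letters G (al j :: l).
  by apply/letters_cons; split=> //; apply: levi_simple.
have := lmax (word dot (al j :: l) x) (ex_intro2 _ _ _ Gjl erefl).
rewrite /= /reflection dotDr dotNr dotZr dot_rho_simple mulr1 gerBl.
by rewrite pmulr_lge0 ?invr_gt0 ?dot_gt0 ?simple_neq0// pmulr_rge0.
Qed.

(* The longest element: it makes [- rho] dominant. *)
Lemma exists_longest_word : exists2 l, letters G l &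
  forall j i, j \notin I -> c i (word dot l (al j)) <= 0.
Proof.
have [l Gl ldom] := orbit_dominant (- rho).
have Gr := letters_rev Gl.
exists (rev l) => // j i jI.
have : dot rho (word dot (rev l) (al j)) <= 0.
  rewrite -(dot_word dot levi_not0 _ _ Gl) (wordK_rev dot levi_not0 Gl).
  by rewrite -oppr_ge0 -dotNl -wordN ldom.
(* If the image is a positive root, each coefficient is at most its height, which is at most 0. *)
have [w0|//] := root_sign (word_root Gr (simple_root j)).
rewrite dot_suml; apply: le_trans; rewrite (bigD1 i)//= lerDl.
exact: sumr_ge0.
Qed.

(** Reading from the right, find the letter [a] at which the image of [al j] turns negative. A
    simple reflection does this only to its own root, so the suffix sends [al j] to [a]; by
    conjugation, deleting [a] amounts to multiplying by the reflection in [al j]. *)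
Lemma exchange l j : letters G l ->
  (forall i, c i (word dot l (al j)) <= 0) ->
  exists l', [/\ letters G l', (size l' < size l)%N &
                 word dot l' =1 word dot l \o s_ (al j)].
Proof.
elim: l => [_ /(_ j)|a l IH].
  by rewrite coord_simple eqxx ler10.
move=> /letters_cons[Ga Gl] neg.
have [pos|{}neg'] := root_sign (word_root Gl (simple_root j)); last first.
  have [l' [Gl' ll' l'E]] := IH Gl neg'.
  exists (a :: l'); split=> //; first exact/letters_cons.
  by move=> x /=; rewrite l'E.
exists l; split=> // x /=.
have [i _ ai] := (leviE a).1 Ga.
have aE : word dot l (al j) = a.
  rewrite ai; apply: reflection_simple_neg pos _.
    exact: word_root (simple_root j).
  by rewrite -ai.
rewrite -(word_refl_conj dot levi_not0)// aE reflectionK// ai.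
exact: simple_neq0.
Qed.

(** Induct on the length, looking at the last letter [al j]. If the word keeps [al j] positive, the
    prefix makes it negative and exchange shortens the word. Otherwise [(theta, al j)] equals the
    pairing of [theta] with a negative root, so it vanishes by dominance, and the letter already
    fixes [theta]. *)
Lemma stabilizer_theta l : letters G l -> word dot l theta = theta ->
  exists2 l', letters (G `&` [set x | dot x theta = 0]) l' &
              word dot l' = word dot l.
Proof.
have [k] := ubnP (size l); elim: k l => // k IH l.
case/lastP: l => [_ _ _|l a]; first by exists [::].
rewrite size_rcons ltnS => lk.
rewrite -cats1 => Gla; have Gl : letters G l.
  by move=> b lb; apply: Gla; rewrite mem_cat lb.
have Ga : G a by apply: Gla; rewrite mem_cat mem_seq1 eqxx orbT.
have [j jI aE] := (leviE a).1 Ga; subst a.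
have wE : word dot (l ++ [:: al j]) = word dot l \o s_ (al j).
  by apply/funext => x; rewrite word_cat.
rewrite wE => wth.
have [pos|neg] := root_sign (word_root Gla (simple_root j)).
  have [|l' [Gl' ll' l'E]] := @exchange l j Gl.
    move=> i; have := pos i; rewrite wE /= reflection_self ?simple_neq0//.
    by rewrite wordN dotNr oppr_ge0.
  have {}l'E : word dot l' = word dot l \o s_ (al j) by apply/funext.
  rewrite -l'E; apply: IH => //; first exact: ltn_trans ll' lk.
  by rewrite l'E.
have th0 : dot theta (al j) = 0.
  apply/le_anti; rewrite theta_dominant andbT.
  rewrite -(dot_word dot levi_not0 _ _ Gla) {1}wE wth dot_coord.
  by apply: sumr_le0 => i _; rewrite mulr_le0_ge0// theta_dominant.
have sth : s_ (al j) theta = theta.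
  by rewrite /reflection th0 mulr0 mul0r scale0r subr0.
have [|||l' Gl' l'E] := IH l => //; first by rewrite -[RHS]wth /= sth.
exists (l' ++ [:: al j]); last by apply/funext => x; rewrite word_cat l'E.
apply: letters_cat => // b; rewrite inE => /eqP->; split=> //=.
by rewrite dotC.
Qed.

(** The difference [theta - b] is a nonnegative combination of simple roots outside [I], each
    pairing nonnegatively with [b]. *)
Lemma dominant_dot_theta b :
  Phi b -> (forall i, i \in I -> c i b = m i) ->
  (forall j, j \notin I -> 0 <= dot b (al j)) -> dot b b <= dot b theta.
Proof.
move=> Pb bI bdom; rewrite -subr_ge0 -dotNr -dotDr dot_coord.
apply: sumr_ge0 => i _; rewrite dotDr dotNr coord_theta.
have [iI|iI] := boolP (i \in I); first by rewrite bI// subrr mul0r.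
by rewrite mulr_ge0 ?bdom// subr_ge0 coord_le.
Qed.

End Parabolic.

(** * Long roots *)

(** With [I] empty, make [b] dominant for the whole Weyl group; then
    [(b, b) <= (b, theta) <= (theta, theta)]. *)
Lemma theta_long b : Phi b -> dot b b <= dot theta theta.
Proof.
move=> Pb; have [l Gl ldom] := orbit_dominant finset.set0 b.
rewrite -(dot_word dot (@levi_not0 _) _ _ Gl).
have Pw := word_root Gl Pb.
apply: le_trans (@dominant_dot_theta finset.set0 _ Pw _ ldom) _.
  by move=> i; rewrite inE.
rewrite dotC -subr_ge0 -dotNr -dotDr dot_coord; apply: sumr_ge0 => i _.
by rewrite mulr_ge0 ?theta_dominant// dotDr dotNr coord_theta subr_ge0 coord_le.
Qed.

Lemma longE b : long dot Phi b <-> Phi b /\ dot b b = dot theta theta.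
Proof.
split=> [[Pb bl]|[Pb bE]]; split=> //; last by move=> a /theta_long; rewrite bE.
by apply/le_anti; rewrite theta_long//= bl//; apply: theta_root.
Qed.

Lemma long_reflection a b : Phi a -> long dot Phi b -> long dot Phi (s_ a b).
Proof.
move=> Pa /longE[Pb bE]; apply/longE; split; first exact: (rs_refl hPhi).
by rewrite dot_reflection// root_neq0.
Qed.

(* The roots orthogonal to all long roots are orthogonal to the remaining ones:
   if [b] is not orthogonal to a long [g], then [b] is a combination of the long
   roots [g] and [s_ b g]. *)
Lemma exists_long_not_orthogonal a : Phi a ->
  exists2 g, long dot Phi g & dot a g != 0.
Proof.
move=> Pa.
pose A := [set x | Phi x /\ forall g, long dot Phi g -> dot x g = 0].
pose B := [set x | Phi x /\ exists2 g, long dot Phi g & dot x g != 0].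
have PAB : Phi = A `|` B.
  apply/seteqP; split=> [x Px|x [[]|[]]//].
  have [xB|nxB] := pselect (B x); [by right|left; split=> // g Lg].
  by apply/eqP; apply: contra_notT nxB => xg; split=> //; exists g.
have [x y [Px Ax] [Py [g Lg yg]]|A0|B0] := rs_irreducible hPhi PAB.
- have := Ax _ (long_reflection Py Lg).
  rewrite /reflection dotDr dotNr dotZr (Ax g)// sub0r => /eqP.
  rewrite oppr_eq0 !mulf_eq0 invr_eq0 pnatr_eq0 /= dotC (negbTE yg) /=.
  by rewrite (negbTE (dot_neq0 dot (root_neq0 Py))) => /eqP.
- suff [] : B a by [].
  by move: Pa; rewrite {1}PAB A0 set0U.
- exfalso; suff : B theta by rewrite B0.
  split; first exact: theta_root.
  exists theta; first by apply/longE; split=> //; exact: theta_root.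
  exact/dot_neq0/root_neq0/theta_root.
Qed.

(** * The root polytope, the face and its vertices *)

Lemma conv_sub (A : set V) x : A x -> conv A x.
Proof.
move=> Ax; exists 1%N, (fun=> x), (fun=> 1); split=> //; split=> //.
by rewrite !big_ord1 scale1r.
Qed.

Lemma coord_conv_le x i : conv Phi x -> c i x <= m i.
Proof.
move=> [k [p [d [Pp [d0 [d1 ->]]]]]].
rewrite dot_sumr -[m i]mul1r -d1 mulr_suml; apply: ler_sum => j _.
by rewrite dotZr ler_wpM2l// coord_le.
Qed.

Section Face.
Variable I : {set 'I_n}.
Local Notation G := (simple al finset.setT `\` simple al I).
Local Notation F := (root_polytope_face dot Phi m om I).

Lemma face_rootE b : (F `&` Phi) b <-> Phi b /\ forall i, i \in I -> c i b = m i.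
Proof.
split=> [[[_ bI] Pb]|[Pb bI]]; split=> //; first by move=> i /bI; rewrite dotC.
by split; [exact: conv_sub|move=> i /bI; rewrite dotC].
Qed.

Lemma theta_face : (F `&` Phi) theta.
Proof. by apply/face_rootE; split; [exact: theta_root|move=> *; exact: coord_theta]. Qed.

Lemma face_is_face : is_face dot (conv Phi) F.
Proof.
have [I0|[i0 iI]] := set_0Vmem I.
  left; apply/seteqP; split=> [x []//|x Px]; split=> // i.
  by rewrite I0 inE.
right; exists (\sum_(i in I) om i), (\sum_(i in I) m i); split.
(* The functional is nonzero because it takes the value 1 on [al i0]. *)
- apply: contra_eq_neq (dot0l dot (al i0)) => <-.
  rewrite dot_suml (bigD1 i0)//= coord_simple eqxx big1 ?addr0 ?oner_eq0// => i /andP[_].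
  by move=> /negbTE ij; rewrite coord_simple ij.
- move=> x Px; rewrite dot_sumr; apply: ler_sum => i _.
  by rewrite dotC coord_conv_le.
- apply/seteqP; split=> x [Px xI]; split=> //.
    by rewrite dot_sumr; apply: eq_bigr => i /xI.
  move=> i iI'; have : \sum_(i in I) (m i - c i x) = 0.
    rewrite sumrB -xI dot_sumr; under [X in _ - X]eq_bigr do rewrite dotC.
    by rewrite subrr.
  move=> s0; have nn j : j \in I -> 0 <= m j - c j x.
    by rewrite subr_ge0 coord_conv_le.
  by have /eqP := psumr_eq0P nn s0 iI'; rewrite subr_eq0 dotC => /eqP.
- by exists theta; case: theta_face.
Qed.

(** Tightness is used twice: the coefficients indexed by [I] are maximal at [x], so roots of
    positive weight lie in the face; the functional exposing [x] in the face then forces them to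
    equal [x]. *)
Lemma vertex_combination x k (p : 'I_k -> V) (d : 'I_k -> R) :
  vertices dot F x -> (forall j : 'I_k, Phi (p j)) -> (forall j : 'I_k, 0 <= d j) ->
  \sum_j d j = 1 -> x = \sum_j d j *: p j -> forall j : 'I_k, 0 < d j -> p j = x.
Proof.
move=> vx Pp d0 d1 xE.
have Fx : F x.
  case: vx => [<-//|[v [e [_ _ xF _]]]].
  by have : [set x] x by []; rewrite xF => -[].
have Fp (j : 'I_k) : 0 < d j -> F (p j).
  move=> dj; split; first exact: conv_sub.
  move=> i iI; rewrite dotC.
  apply: (tight_combination (g := fun l => c i (p l)) d0 d1 _ _ dj) => [l _|]; first exact: coord_le.
  have [_ /(_ i iI) <-] := Fx; rewrite dotC xE dot_sumr.
  by apply: eq_bigr => l _; rewrite dotZr.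
move=> j dj; have := Fp j dj.
case: vx => [<-//|[v [e [_ ve xF _]]]] Fj.
suff : [set x] (p j) by [].
rewrite xF; split=> //.
apply: (tight_combination (g := fun l => dot (p l) v) d0 d1 _ _ dj) => [l dl|]; first exact/ve/Fp.
have : [set x] x by [].
rewrite xF => -[_ <-]; rewrite xE dot_suml.
by apply: eq_bigr => l _; rewrite dotZl.
Qed.

Lemma vertex_root x : vertices dot F x -> (F `&` Phi) x.
Proof.
move=> vx; have Fx : F x.
  case: vx => [<-//|[v [e [_ _ xF _]]]].
  by have : [set x] x by []; rewrite xF => -[].
have [[k [p [d [Pp [d0 [d1 xE]]]]]] _] := Fx.
split=> //; have [j dj] : exists j : 'I_k, 0 < d j.
  apply: contrapT => nd; have : \sum_j d j = 0.
    apply: big1 => j _; apply/le_anti; rewrite d0 andbT leNgt.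
    by apply/negP => dj; apply: nd; exists j.
  by move/eqP; rewrite d1 oner_eq0.
by rewrite -(vertex_combination vx Pp d0 d1 xE dj).
Qed.

(* If [x] is short and [g] is long with [k := <g, x^v> >= 2], then [x] is the
   convex combination of [g], [- s_x g] and [0 = (g + (- g)) / 2] with weights
   [1/k], [1/k] and [1 - 2/k]. *)
Lemma vertex_long x : vertices dot F x -> long dot Phi x.
Proof.
move=> vx; have [Fx Px] := vertex_root vx; apply: contrapT => sx.
have [g [Pg gl] xg] : exists2 g, long dot Phi g & 0 < dot x g.
  have [g Lg] := exists_long_not_orthogonal Px.
  rewrite neq_lt => /orP[xg|xg]; [exists (- g)|by exists g].
    by case: Lg => Pg gl; split; [exact: rootN|move=> b /gl; rewrite dotNl dotNr opprK].
  by rewrite dotNr oppr_gt0.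
have xx : 0 < dot x x by apply/dot_gt0/root_neq0.
have gg : 0 < dot g g by apply/dot_gt0/root_neq0.
have xlg : dot x x < dot g g.
  rewrite ltNge; apply/negP => gx; apply: sx; split=> // b /gl bg.
  exact: le_trans bg gx.
have xNg : x != g by apply: contraTneq xlg => ->; rewrite ltxx.
have lt2 : 2 * dot x g / dot g g < 2.
  rewrite ltr_pdivrMr//; apply: lt_trans (dot_lt_mean dot xNg) _; lra.
(* A Cartan integer strictly between 0 and 2. *)
have kE : 2 * dot x g / dot g g = 1.
  have /intrP[z zE] := rs_crystallographic hPhi Pg Px.
  have : 0 < 2 * dot x g / dot g g by rewrite divr_gt0// mulr_gt0.
  move: lt2; rewrite zE -[2]/(2%:~R) -[0]/(0%:~R) !ltr_int => z2 z0.
  have -> : z = 1 by lia.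
  by [].
have xgE : 2 * dot x g = dot g g 
  by rewrite -[LHS](divfK (lt0r_neq0 gg)) kE mul1r.
(* This ratio of squared lengths is the Cartan integer of [g] against [x], so exceeding 1 makes it
   at least 2. *)
have [z zE] : exists z : int, dot g g / dot x x = z%:~R.
  have /intrP[z zE] := rs_crystallographic hPhi Px Pg.
  by exists z; rewrite -zE -xgE dotC.
have z2 : (2 : R) <= dot g g / dot x x.
  have : 1 < dot g g / dot x x by rewrite ltr_pdivlMr// mul1r.
  by rewrite zE -[2]/(2%:~R) -[1]/(1%:~R) ltr_int ler_int; lia.
pose k := dot g g / dot x x.
have k0 : 0 < k by apply: lt_le_trans z2.
have sxg : s_ x g = g - k *: x by rewrite /reflection (dotC _ g) xgE.
pose p := [tuple g; - s_ x g; g; - g].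
pose d := [tuple k^-1; k^-1; (1 - 2 / k) / 2; (1 - 2 / k) / 2].
have k2 : 0 <= 1 - 2 / k by rewrite subr_ge0 ler_pdivrMr// mul1r.
(* The first point [g] has positive weight, so it would equal the strictly shorter [x]. *)
suff gx : tnth p ord0 = x by rewrite -gx /= ltxx in xlg.
apply: (@vertex_combination x 4 (tnth p) (tnth d) vx).
- move=> j; have : tnth p j \in p by exact: mem_tnth.
  by rewrite !inE => /or4P[] /eqP->; do ?apply: rootN; do ?apply: (rs_refl hPhi).
- move=> j; have : tnth d j \in d by exact: mem_tnth.
  by rewrite !inE => /or4P[] /eqP->; (rewrite divr_ge0 || rewrite invr_ge0 ltW).
- rewrite !big_ord_recl big_ord0 !(tnth_nth 0) /=.
  by field; rewrite gt_eqF.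
- rewrite !big_ord_recl big_ord0 !(tnth_nth 0) /= sxg opprB scalerBr scalerN addr0 subrr.
  by rewrite addr0 addrC subrK scalerA mulVf ?scale1r// gt_eqF.
- by rewrite (tnth_nth 0) /= invr_gt0.
Qed.

Lemma long_vertex x : (F `&` Phi) x -> long dot Phi x -> vertices dot F x.
Proof.
move=> [Fx Px] /longE[_ xl]; right; exists x, (dot x x).
have Pxb b : Phi b -> dot x b <= dot x x ?= iff (b == x).
  move=> Pb; apply/leifP; case: eqVneq => [->//|bx].
  have := dot_lt_mean dot bx; have := theta_long Pb; rewrite (dotC dot b) xl; lra.
have Pxc b : conv Phi b -> dot x b <= dot x x.
  move=> [k [p [d [Pp [d0 [d1 ->]]]]]].
  rewrite dot_sumr -[leRHS]mul1r -d1 mulr_suml; apply: ler_sum => j _.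
  by rewrite dotZr ler_wpM2l// Pxb.
split; first exact: root_neq0.
- by move=> b [/Pxc]; rewrite dotC.
- apply/seteqP; split=> [_ ->//|b [[Pb bI] bE]] /=.
  have [k [p [d [Pp [d0 [d1 bE']]]]]] := Pb.
  have px (j : 'I_k) : 0 < d j -> p j = x.
    move=> dj; apply/eqP; rewrite -(Pxb _ (Pp j)); apply/eqP.
    apply: (tight_combination (g := fun l => dot x (p l)) d0 d1 _ _ dj) => [i _|]; first exact: Pxb.
    by rewrite -bE dotC bE' dot_sumr; apply: eq_bigr => i _; rewrite dotZr.
  rewrite bE' -[RHS]scale1r -d1 scaler_suml; apply: eq_bigr => j _.
  have [/px->//|dj] := ltP 0 (d j).
  by rewrite (le_anti (introT andP (conj dj (d0 j)))) !scale0r.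
- by exists x.
Qed.

Lemma vertexE x : vertices dot F x <-> (F `&` Phi) x /\ long dot Phi x.
Proof.
split=> [vx|[]]; last exact: long_vertex.
by split; [exact: vertex_root|exact: vertex_long].
Qed.

Lemma face_root_word l b :
  letters G l -> (F `&` Phi) b -> (F `&` Phi) (word dot l b).
Proof.
move=> Gl /face_rootE[Pb bI]; apply/face_rootE; split; first exact: word_root Gl Pb.
by move=> i iI; rewrite (coord_word _ Gl iI) bI.
Qed.

Lemma verticesE : vertices dot F = [set g theta | g in refl_group dot G].
Proof.
rewrite (refl_groupE dot (@levi_not0 I)); apply/seteqP; split=> [x|_ [_ [l Gl <-] <-]].
  move=> /vertexE[Fx /longE[Px xl]].
  have [l Gl ldom] := orbit_dominant I x.
  have [Pw wI] := (face_rootE _).1 (face_root_word Gl Fx).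
  (* The two roots have equal length and [(w, w) <= (w, theta)] for the dominant image [w] of [x];
     distinct roots would violate the strict inequality. *)
  have wth : word dot l x = theta.
    apply/eqP; apply: contraT => /(dot_lt_mean dot).
    have := dominant_dot_theta Pw wI ldom.
    rewrite (dot_word dot (@levi_not0 I))// xl; lra.
  exists (word dot (rev l)); first by exists (rev l) => //; exact: letters_rev.
  by rewrite -wth (word_revK dot (@levi_not0 I)).
apply/vertexE; split; first exact/face_root_word/theta_face.
apply/longE; split; first exact: word_root Gl theta_root.
exact: (dot_word dot (@levi_not0 I)).
Qed.

Lemma card_vertices :
  vertices dot F #= lcosets (refl_group dot G)
                            (refl_group dot (G `&` [set x | dot x theta = 0])).
Proof.
set H := refl_group dot (G `&` _); rewrite verticesE /lcosets.
have H0 : ~ (G `&` [set x | dot x theta = 0]) 0 by move=> [/(@levi_not0 I)].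
have HE := refl_groupE dot H0; rewrite -/H in HE.
have Hid : H id by rewrite HE; exists [::].
have Hth h : H h -> h theta = theta.
  rewrite HE => -[l + <-]; elim: l => // a l IH /letters_cons[[_ ath] Gl] /=.
  by rewrite IH// /reflection dotC ath mulr0 mul0r scale0r subr0.
have HM g h : H g -> H h -> H (g \o h).
  rewrite HE => -[l Gl <-] [l' Gl' <-]; exists (l ++ l'); first exact: letters_cat.
  by apply/funext => x; rewrite word_cat.
apply: card_eq_fiberwise.
rewrite (refl_groupE dot (@levi_not0 I)) => _ _ [l Gl <-] [l' Gl' <-].
have sub l1 l2 : letters G l1 -> letters G l2 -> word dot l1 theta = word dot l2 theta ->
    [set word dot l1 \o h | h in H] `<=` [set word dot l2 \o h | h in H].
  move=> G1 G2 e12 _ [h Hh <-].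
  (* The inverse of [l2] followed on the right by [l1] fixes [theta], so it lies in [H]. *)
  have G21 := letters_cat (letters_rev G2) G1.
  have [|l3 H3 l3E] := @stabilizer_theta I _ G21.
    by rewrite word_cat e12 (word_revK dot (@levi_not0 I)).
  exists (word dot l3 \o h); first by apply: HM => //; rewrite HE; exists l3.
  apply/funext => x /=; rewrite l3E word_cat.
  by rewrite (wordK_rev dot (@levi_not0 I)).
split=> [e|/seteqP[sub1 _]].
  by apply/seteqP; split; apply: sub.
have [h Hh hE] : [set word dot l' \o h | h in H] (word dot l).
  by apply: sub1; exists id.
by rewrite -hE /= Hth.
Qed.

(** * The roots of the face as a principal abelian ideal *)

Lemma dual_ideal_face : I != finset.set0 -> dual_order_ideal Phi al (F `&` Phi).
Proof.
move=> /set0Pn[i0 i0I]; split=> [b /face_rootE[Pb bI]|a b /face_rootE[Pa aI]].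
  apply/posE; split=> //; case: (root_sign Pb) => // /(_ i0).
  by rewrite bI// leNgt m_gt0.
move=> /posE[Pb _] /root_leE ab; apply/face_rootE; split=> // i iI.
by apply/le_anti; rewrite coord_le//= -(aI i iI) ab.
Qed.

(** The sum would have [i]-th coefficient [2 m_i], above the maximum [m_i]. *)
Lemma abelian_face : I != finset.set0 -> abelian_roots Phi (F `&` Phi).
Proof.
move=> /set0Pn[i iI] a b /face_rootE[_ aI] /face_rootE[_ bI] /(coord_le i).
by rewrite dotDr aI// bI// gerDl leNgt m_gt0.
Qed.

(** With [w] the longest element, write [b - w theta] as [w (w^-1 b - theta)]. The inner difference
    has nonpositive coefficients, zero on [I], and [w] sends the remaining simple roots to negative
    ones. *)
Lemma principal_face : principal Phi al (F `&` Phi).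
Proof.
have [l Gl lneg] := exists_longest_word I.
have Gr := letters_rev Gl.
exists (word dot l theta); first exact/face_root_word/theta_face.
move=> b Fb; apply/root_leE => i; rewrite -subr_ge0 -dotNr -dotDr.
have [Pb' bI'] := (face_rootE _).1 (face_root_word Gr Fb).
rewrite -[b](wordK_rev dot (@levi_not0 I) Gl) -wordN -wordD.
set b' := word dot (rev l) b in Pb' bI' *.
rewrite (coordE (b' - theta)) word_sum dot_sumr; apply: sumr_ge0 => j _.
rewrite wordZ dotZr dotDr dotNr coord_theta.
have [jI|jI] := boolP (j \in I); first by rewrite bI'// subrr mul0r.
by rewrite mulr_le0 ?lneg// subr_le0 coord_le.
Qed.

(** * Generated subsystems and the affine bijection *)

(** Take a counterexample of least height. Some Levi simple root pairs positively with it;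
    reflecting lowers the height and keeps the root positive unless it is that simple root. A
    general [S] serves both the finite subsystem and the level-zero slice of the affine one. *)
Lemma levi_root_subsystem (S : set V) b :
  (forall a b, S a -> S b -> S (s_ a b)) -> (forall a, G a -> S a) ->
  Phi b -> (forall i, 0 <= c i b) -> (forall i, i \in I -> c i b = 0) -> S b.
Proof.
move=> Srefl GS Pb b0 bI; apply: contrapT => nSb.
pose B := [set b | [/\ Phi b, forall i, 0 <= c i b,
                       forall i, i \in I -> c i b = 0 & ~ S b]].
have fB : finite_set B.
  by apply: sub_finite_set (rs_finite hPhi) => x [].
have [|x [Px x0 xI nSx] xmin] := finite_set_argmin (fun y => dot (\sum_i om i) y) fB.
  by exists b.
have [j cj] : exists j, 0 < c j x * dot x (al j).
  apply: contrapT => nj; have := dot_gt0 dot (root_neq0 Px).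
  rewrite dot_coord ltNge => /negP; apply; apply: sumr_le0 => j _.
  by rewrite leNgt; apply/negP => cj; apply: nj; exists j.
have jI : j \notin I by apply: contraTN cj => /xI ->; rewrite mul0r ltxx.
have Sj : S (al j) by apply/GS/levi_simple.
have xj : 0 < dot x (al j).
  rewrite ltNge; apply/negP => xj.
  by move: cj; rewrite ltNge mulr_ge0_le0.
have Ps : Phi (s_ (al j) x) by apply: (rs_refl hPhi) => //; exact: simple_root.
have [sx0|sx0] := root_sign Ps; last first.
  by apply: nSx; rewrite (reflection_simple_neg Px x0 sx0).
have nSs : ~ S (s_ (al j) x).
  by move=> Ss; apply: nSx; rewrite -(reflectionK dot (simple_neq0 j) x); apply: Srefl.
have /xmin : B (s_ (al j) x).
  split=> // i iI; rewrite coord_reflection_neq ?xI//.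
  by apply: contraNneq jI => <-.
rewrite /reflection dotDr dotNr dotZr dot_rho_simple mulr1 lerDl oppr_ge0 leNgt.
by rewrite divr_gt0 ?mulr_gt0 ?dot_gt0 ?simple_neq0.
Qed.

Local Notation aS := (aff_simple al theta `\` aff_incl (simple al I)).
Local Notation aff_s := (reflection (aff_dot dot)).

Lemma aff_reflection1 (x y : V * R^o) : (aff_s x y).1 = s_ x.1 y.1.
Proof. by []. Qed.

(** The condition is linear, hence stable under reflections among affine roots, and it holds on the
    generators. *)
Lemma aff_coord_gen (x : V * R^o) i : i \in I ->
  gen_subsystem (aff_dot dot) (aff_roots Phi) aS x -> c i x.1 = - (x.2 * m i).
Proof.
move=> iI; pose S := [set x : V * R^o | aff_roots Phi x /\ c i x.1 = - (x.2 * m i)].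
move=> xS; suff : S x by case.
have Sgen : aS `<=` S.
  move=> _ [[[_ [j _ <-] <-]|->] jI].
    split; first by split; [exact: simple_root|exists 0].
    rewrite /= mul0r oppr0 coord_simple; case: eqVneq => // ij.
    by case: jI; exists (al j) => //; exists j => //=; rewrite -ij.
  split; first by split; [exact/rootN/theta_root|exists 1].
  by rewrite /= dotNr coord_theta mul1r.
apply: xS; split=> //; split=> [y []//|y z [[Py [k yk]] yi] [[Pz [k' zk]] zi]].
split.
  split; first exact: (rs_refl hPhi).
  have /intrP[q qE] := rs_crystallographic hPhi Py Pz.
  exists (k' - q * k); rewrite /= /aff_dot qE yk zk.
  by rewrite intrB intrM.
rewrite aff_reflection1 /reflection dotDr dotNr dotZr yi zi /=.
by rewrite /aff_dot /GRing.scale /=; ring.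
Qed.

Lemma aff_gen_levi b : Phi b -> (forall i, 0 <= c i b) ->
  (forall i, i \in I -> c i b = 0) ->
  gen_subsystem (aff_dot dot) (aff_roots Phi) aS (b, 0).
Proof.
move=> Pb b0 bI T [[_ Trefl] Tgen].
pose S := [set x : V | T (x, 0)].
apply: (levi_root_subsystem (S := S)) bI => // [x y Sx Sy|a /leviE[j jI ->]].
  have := Trefl _ _ Sx Sy; rewrite {1}/reflection /aff_dot /S /=; congr T.
  by congr (_, _); rewrite /= scaler0 subr0.
apply: Tgen; split; first by left; exists (al j) => //; exists j => //=; rewrite inE.
by move=> [_ [i /= iI <-] [/al_inj ij]]; rewrite -ij iI in jI.
Qed.

Lemma gen_levi b : Phi b -> (forall i, 0 <= c i b) ->
  (forall i, i \in I -> c i b = 0) -> gen_subsystem dot Phi G b.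
Proof.
move=> Pb b0 bI T [[_ Trefl] Tgen].
exact: (levi_root_subsystem (S := T)) bI.
Qed.

(* Moving [b] by the Levi Weyl group we may assume that it is Levi-dominant; then
   [b = theta] or [s_theta b = b - theta], in which case the affine root
   [delta - b] is the image of [theta - b] under the reflection in [alpha_0]. *)
Lemma aff_gen_face b : (F `&` Phi) b ->
  gen_subsystem (aff_dot dot) (aff_roots Phi) aS (- b, 1).
Proof.
move=> Fb; have [l Gl ldom] := orbit_dominant I b.
have [Pw wI] := (face_rootE _).1 (face_root_word Gl Fb).
set w := word dot l b in ldom Pw wI.
(* Reflections in level-zero roots preserve the level, so undoing [l] leads from [- w] back to [- b]
   at level 1. *)
suff Sw : gen_subsystem (aff_dot dot) (aff_roots Phi) aS (- w, 1).
  move=> T TP; have [[_ Trefl] _] := TP.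
  have Twl l' x : letters G l' -> T (x, 1) -> T (word dot l' x, 1).
    elim: l' => // a l' IH /letters_cons[Ga Gl'] Tx /=.
    have Ta : T (a, 0).
      have [j jI ->] := (leviE I a).1 Ga.
      apply: (aff_gen_levi (simple_root j)) TP => i; first by rewrite coord_simple ler0n.
      by move=> iI; rewrite coord_simple; case: eqVneq => // ij; rewrite -ij iI in jI.
    have := Trefl _ _ Ta (IH Gl' Tx); congr T.
    by congr (_, _); rewrite /= scaler0 subr0.
  have := Twl _ _ (letters_rev Gl) (Sw T TP).
  by rewrite wordN (word_revK dot (@levi_not0 I)).
have Sth : aS (- theta, 1).
  split; first by right.
  by move=> [x _ [_ /eqP]]; rewrite eq_sym oner_eq0.
have [wth|wth] := eqVneq w theta; first by rewrite wth => T [_]; apply.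
have ww : 0 < dot w w by apply/dot_gt0/root_neq0.
have tt : 0 < dot theta theta by apply/dot_gt0/root_neq0/theta_root.
have wt := dominant_dot_theta Pw wI ldom.
(* Positive since [(w, w) <= (w, theta)], and below 2 since [w] differs from [theta] and is no
   longer than it. *)
have kE : 2 * dot w theta / dot theta theta = 1.
  have /intrP[z zE] := rs_crystallographic hPhi theta_root Pw.
  have z0 : 0 < 2 * dot w theta / dot theta theta.
    by rewrite divr_gt0// mulr_gt0//; apply: lt_le_trans wt.
  have : 2 * dot w theta / dot theta theta < 2.
    rewrite ltr_pdivrMr//; have := dot_lt_mean dot wth; have := theta_long Pw; lra.
  move: z0; rewrite zE -[2]/(2%:~R) -[0]/(0%:~R) !ltr_int => z0 z2.
  have -> : z = 1 by lia.
  by [].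
have Pd : Phi (theta - w).
  rewrite -opprB; apply: rootN; have := rs_refl hPhi theta_root Pw.
  by rewrite /reflection kE scale1r.
move=> T TP; have [[_ Trefl] Tgen] := TP.
have Td : T (theta - w, 0).
  apply: (aff_gen_levi Pd) TP => i.
    by rewrite dotDr dotNr coord_theta subr_ge0 coord_le.
  by move=> iI; rewrite dotDr dotNr coord_theta wI ?subrr.
have := Trefl _ _ (Tgen _ Sth) Td.
have -> : aff_s (- theta, 1) (theta - w, 0) = (- w, 1).
  rewrite /reflection /aff_dot /=.
  have -> : 2 * dot (theta - w) (- theta) / dot (- theta) (- theta) = -1.
    have wtE : dot w theta = dot theta theta / 2.
      have := divfK (lt0r_neq0 tt) (2 * dot w theta); rewrite kE; lra.
    by rewrite !dotE wtE; field; rewrite gt_eqF.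
  by congr (_, _); rewrite /= scaleN1r ?opprK ?add0r// addrC addKr.
by [].
Qed.

Lemma aff_diff_bij : I != finset.set0 ->
  set_bij (F `&` Phi) (aff_diff dot Phi al theta I) (fun b => (- b, 1)).
Proof.
move=> /set0Pn[i0 i0I]; split.
- move=> b Fb; have [_ Pb] := Fb; split; first by right; split; [exact: rootN|exists 1].
  split; first exact: aff_gen_face.
  by move=> [x _ [_ /eqP]]; rewrite eq_sym oner_eq0.
- by move=> x y _ _ [/oppr_inj].
move=> [x k] [xpos [xgen xfin]].
have xI i : i \in I -> c i x = - (k * m i) by move=> /aff_coord_gen/(_ xgen).
(* At level 0 the coefficients on [I] vanish, so the root lies in the finite Levi subsystem, which
   is removed. *)
case: xpos => [[y /posE[Py y0] [yx k0]]|[/= Px [z z1 kz]]].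
  subst y k; case: xfin; exists x => //; apply: gen_levi => // i iI.
  by rewrite xI// mul0r oppr0.
(* The root [- x] has [i0]-th coefficient [z * m i0], at most [m i0], which bounds the level by
   1. *)
have {}z1 : z = 1.
  apply/le_anti; rewrite z1 andbT.
  have := coord_le i0 (rootN Px); rewrite dotNr xI// opprK.
  by rewrite ger_pMl ?m_gt0// kz -[1]/(1%:~R) ler_int.
rewrite {}z1 in kz; subst k.
exists (- x); last by rewrite opprK.
apply/face_rootE; split; first exact: rootN.
by move=> i iI; rewrite dotNr xI// opprK mul1r.
Qed.

End Face.
End RootSystem.

Theorem mainTheorem1 (R : realType) (V : vectType R) (dot : {dot V for idfun})
    (Phi : set V) (n : nat) (al : 'I_n -> V) (theta : V)
    (m : 'I_n -> R) (om : 'I_n -> V) (I : {set 'I_n})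
    (hPhi : irreducible_root_system dot Phi)
    (hPi : root_basis Phi al)
    (htheta : highest_root Phi al theta)
    (hm : theta = \sum_(i < n) m i *: al i)
    (hom : forall i j, dot (om i) (al j) = (i == j)%:R) :
  let Pi := simple al finset.setT in
  let PiI := simple al I in
  let F := root_polytope_face dot Phi m om I in
  let VI := F `&` Phi in
  [/\ is_face dot (conv Phi) F,
      I != finset.set0 ->
        [/\ dual_order_ideal Phi al VI, abelian_roots Phi VI &
            principal Phi al VI],
      I != finset.set0 ->
        exists f : V -> V * R^o,
          [/\ set_bij VI (aff_diff dot Phi al theta I) f,
              vertices dot F `<=` VI &
              [set f x | x in vertices dot F] =
              aff_diff dot Phi al theta I `&` aff_long dot Phi] &
      exists N : nat,
        vertices dot F #= `I_N /\
        lcosets (refl_group dot (Pi `\` PiI))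
                (refl_group dot ((Pi `\` PiI) `&` [set x | dot x theta = 0]))
          #= `I_N].
Proof.
move=> Pi PiI F VI; split.
- exact: (face_is_face hPi htheta hm hom).
- move=> I0; split; first exact: (dual_ideal_face hPi htheta hm hom).
    exact: (abelian_face hPi htheta hm hom).
  exact: (principal_face hPhi hPi htheta hm hom).
- move=> I0; have fbij := aff_diff_bij hPhi hPi htheta hm hom I0.
  have vE := vertexE hPhi hPi htheta hm hom I.
  have longN b : long dot Phi (- b) <-> long dot Phi b.
    have aux a : long dot Phi a -> long dot Phi (- a).
      move=> [Pa al_]; split; first exact: (rootN hPhi).
      by move=> d /al_; rewrite dotNl dotNr opprK.
    by split=> /aux; rewrite ?opprK.
  exists (fun b => (- b, 1)); split=> //; first by move=> x /vE[].
  have [ffun _ fsurj] := fbij.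
  apply/seteqP; split=> [_ [x /vE[VIx xl] <-]|y [yA [_ yl]]].
    split; first exact: ffun.
    split; last exact/longN.
    by split; [apply: (rootN hPhi); case: VIx|exists 1].
  have [x VIx xy] := fsurj _ yA; exists x => //; apply/vE; split=> //.
  by apply/longN; rewrite -xy in yl.
- have [N vN] : finite_set (vertices dot F).
    apply: sub_finite_set (rs_finite hPhi) => x.
    by move=> /(vertexE hPhi hPi htheta hm hom)[[]].
  exists N; split=> //; apply: card_eq_trans vN; apply: card_esym.
  exact: (card_vertices hPhi hPi htheta hm hom).
Qed.
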